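(* Let $\mu\in\mathbb{R}$, $\sigma^2>0$, let $n\ge 2$ be an integer and let $0<\alpha<1$. Let $$L_{n}=\sigma^2\left(\frac{1}{\chi^{2}_{n-1;\,\alpha/2}/(n-1)}-\frac{1}{\chi^{2}_{n-1;\,1-\alpha/2}/(n-1)}\right)$$ be the average length of the standard level $1-\alpha$ confidence interval for $\sigma^2$ based on a sample of size $n$ from $N(\mu,\sigma^2)$, and let $L_{n+1}$ be the same quantity with $n$ replaced by $n+1$ (with the same $\sigma^2,\alpha$). If $\alpha<\alpha^{*}(n)$, then $L_n>L_{n+1}$.
   Context: For $0<p<1$, $\chi^2_{d;\,p}$ denotes the quantile of order $p$ of the chi-square distribution with $d$ degrees of freedom (the point at which its distribution function equals $p$). If $X_1,\ldots,X_n$ are i.i.d. $N(\mu,\sigma^2)$ with both parameters unknown and $S_n^2=\frac{1}{n-1}\sum_{i=1}^n (X_i-\overline{X}_n)^2$ is the sample variance, the standard confidence interval of level $1-\alpha$ for $\sigma^2$ is $\left(\frac{(n-1)S_{n}^2}{\chi^{2}_{n-1;\,1-\alpha/2}},\ \frac{(n-1)S_{n}^2}{\chi^{2}_{n-1;\,\alpha/2}}\right)$. Its average (expected) length is $L_n$. For $a>0,\beta>0$, $Gamma(a,\beta)$ is the distribution with density $\frac{1}{\beta^{a}\Gamma(a)}x^{a-1}e^{-x/\beta}$, $x>0$; if $X\sim\chi^2_d$ then $X/d\sim Gamma\left(\frac d2,\frac 2d\right)$. Definition of $\alpha^*(n)$: let $F_1$ be the distribution function of $Gamma\left(\frac{n-1}{2},\frac{2}{n-1}\right)$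 and $F_2$ that of $Gamma\left(\frac{n}{2},\frac{2}{n}\right)$. There is a unique $x^*>0$ such that $F_1(x)>F_2(x)$ for $0<x<x^*$ and $F_1(x)<F_2(x)$ for $x>x^*$; then $\alpha^{*}(n)=F_1(x^* )=F_2(x^* )$. *)

(* Defs.v *)
From HB Require Import structures.
From mathcomp Require Import all_boot all_order all_algebra.
From mathcomp Require Import all_classical all_reals all_analysis.

Set Implicit Arguments.
Unset Strict Implicit.
Unset Printing Implicit Defensive.

Import Order.TTheory GRing.Theory Num.Theory.
Import numFieldNormedType.Exports.

Local Open Scope classical_set_scope.
Local Open Scope ring_scope.

Section gamma_distribution.
Context {R : realType}.
Implicit Types a b x p alpha : R.

Definition gamma_fun a : R :=
  \int[lebesgue_measure]_(x in `]0, +oo[) (x `^ (a - 1) * expR (- x)).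

(* [b] is a scale parameter (not a rate). *)
Definition gamma_pdf a b : R -> R :=
  (fun x => (b `^ a * gamma_fun a)^-1 * x `^ (a - 1) * expR (- (x / b)))
    \_ `]0, +oo[.

Definition gamma_prob a b : set R -> \bar R :=
  fun V => (\int[lebesgue_measure]_(x in V) (gamma_pdf a b x)%:E)%E.

Definition gamma_cdf a b x : R := fine (gamma_prob a b `]-oo, x]).

(* The density is x^(d/2-1) e^(-x/2) / (2^(d/2) Gamma(d/2)) on x > 0. *)
Definition chi2_cdf (d : nat) : R -> R := gamma_cdf (d%:R / 2) 2.

(* For d > 0 and 0 < p < 1 there is exactly one such point, because the
   distribution function is continuous, vanishes on ]-oo, 0], increases
   strictly on ]0, +oo[ and tends to 1. *)
Definition chi2_quantile (d : nat) p : R := get [set x | chi2_cdf d x = p].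

(* Distribution function of chi^2_d / d. *)
Definition scaled_chi2_cdf (d : nat) : R -> R :=
  gamma_cdf (d%:R / 2) (2 / d%:R).

Definition cdf_crossing (n : nat) x : Prop :=
  [/\ 0 < x,
      forall y, 0 < y -> y < x -> scaled_chi2_cdf n.-1 y > scaled_chi2_cdf n y
    & forall y, x < y -> scaled_chi2_cdf n.-1 y < scaled_chi2_cdf n y].

(* For n >= 2 the crossing point exists and is unique; the two distribution
   functions agree there by continuity. *)
Definition alpha_star (n : nat) : R :=
  scaled_chi2_cdf n.-1 (get [set x | cdf_crossing n x]).

Definition ci_avg_length (sigma alpha : R) (n : nat) : R :=
  sigma ^+ 2 *
  (1 / (chi2_quantile n.-1 (alpha / 2) / n.-1%:R)
   - 1 / (chi2_quantile n.-1 (1 - alpha / 2) / n.-1%:R)).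

End gamma_distribution.

Section normal_sample.
Context {R : realType} {d : measure_display} {T : measurableType d}
  {P : probability T R} {n : nat}.
Implicit Type X : 'I_n -> {RV P >-> R}.

(* Letting some of the B i be setT gives the product rule for every
   subfamily. *)
Definition mutually_independent X : Prop :=
  forall B : 'I_n -> set R, (forall i, measurable (B i)) ->
    P (\bigcap_(i in [set: 'I_n]) (X i @^-1` B i)) =
    (\prod_(i < n) P (X i @^-1` B i))%E.

(* The second parameter of normal_prob is the standard deviation. *)
Definition iid_normal X (mu sigma : R) : Prop :=
  mutually_independent X /\
  forall (i : 'I_n) (B : set R), measurable B ->
    distribution P (X i) B = normal_prob mu sigma B.

Definition sample_mean X (t : T) : R := n%:R^-1 * \sum_(i < n) X i t.

Definition sample_variance X (t : T) : R :=
  n.-1%:R^-1 * \sum_(i < n) (X i t - sample_mean X t) ^+ 2.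

Definition ci_lower X (alpha : R) (t : T) : R :=
  n.-1%:R * sample_variance X t / chi2_quantile n.-1 (1 - alpha / 2).

Definition ci_upper X (alpha : R) (t : T) : R :=
  n.-1%:R * sample_variance X t / chi2_quantile n.-1 (alpha / 2).

End normal_sample.

(* L is the expected length of the interval for every sample of size n from
   N(mu, sigma^2), on whatever probability space the sample is defined. *)
Definition is_ci_avg_length {R : realType} (mu sigma alpha : R) (n : nat)
    (L : R) : Prop :=
  forall (d : measure_display) (T : measurableType d) (P : probability T R)
    (X : 'I_n -> {RV P >-> R}), iid_normal X mu sigma ->
    ('E_P[fun t => (ci_upper X alpha t - ci_lower X alpha t)%R] = L%:E)%E.

(* Main.v *)
From HB Require Import structures.
Require Import Defs.
From mathcomp Require Import all_boot all_order all_algebra.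
From mathcomp Require Import all_classical all_reals all_analysis.
From mathcomp Require Import measurable_realfun ring lra.

(** Let $X_1$ and $X_2$ follow the scaled chi-square laws with $n-1$ and $n$
    degrees of freedom, with distribution functions $F_1$, $F_2$. Up to the
    factor $\sigma^2$ the two lengths are $1/x_1 - 1/y_1$ and $1/x_2 - 1/y_2$,
    where $x_i$ and $y_i$ are the quantiles of $X_i$ of orders $\alpha/2$ and
    $1 - \alpha/2$.

    The hypothesis $\alpha < \alpha^*$ puts $x_1$ to the left of the crossing
    point, so $F_2(x_1) < F_1(x_1) = \alpha/2$ and $x_1 < x_2$. The upper
    quantiles may be ordered either way. What settles the comparison is that
    $x_2/x_1 \ge y_2/y_1$: gamma laws decrease in the star order when the shape
    parameter grows (gamma_quantile_ratio). Indeed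
    $1/x_1 - 1/x_2 = (x_2/x_1 - 1)/x_2$ then exceeds $(y_2/y_1 - 1)/y_2 =
    1/y_1 - 1/y_2$ (reciprocal_spread).

    The star order is a single-crossing property. For two gamma densities of
    different shapes and arbitrary scales, the logarithm of the ratio is an
    affine function plus a multiple of $\ln$, so one density is below the other
    exactly on an interval (gamma_pdf_le_interval); as both have integral 1,
    their distribution functions can cross only once on the positive half-line
    (single_crossing, gamma_cdf_single_crossing). Rescaling the first law by
    $x_1/x_2$ makes the crossing happen at $x_2$, and the position of the two
    functions at $y_2$ is the inequality of the ratios.

    That the expected length is the stated one amounts to the unbiasedness of
    the sample variance (has_mean_sum_sqr_dev), which needs the first two
    moments of a normal law (second_moment_normal_prob) and the product rule for
    the mean of two independent variables (mean_indep). *)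

Import Order.TTheory GRing.Theory Num.Theory.
Import numFieldNormedType.Exports.
Local Open Scope classical_set_scope.
Local Open Scope ring_scope.

(** * Integrals with respect to Lebesgue measure *)

Lemma lebesgue_measureZ {R : realType} (k : R) (k_gt0 : 0 < k) (A : set R) :
  measurable A ->
  lebesgue_measure A =
  (k%:E * lebesgue_measure ((fun x : R => (k * x)%R) @^-1` A))%E.
Proof.
pose f : measurableTypeR R -> measurableTypeR R := fun x => k * x.
have mf : measurable_fun setT f by exact: measurable_funM.
pose fI := isMeasurableFun.Build _ _ _ _ _ mf.
pose F : {mfun _ >-> _} := HB.pack f fI.
pose kn : {nonneg R} := NngNum (ltW k_gt0).
move=> mA; apply: (@lebesgue_measure_unique R
  (mscale kn (pushforward lebesgue_measure F))) => // _ [[a b]] _ <-.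
transitivity (k%:E * lebesgue_measure `](a / k)%R, (b / k)%R]%classic)%E.
  rewrite !lebesgue_measure_itv/= !lte_fin ltr_pM2r ?invr_gt0//.
  case: ifPn => // _; last by rewrite mule0.
  by rewrite -!EFinD -EFinM -mulrBl mulrC divfK// gt_eqF.
rewrite /mscale /= /mscale /pushforward /=; congr (_ * lebesgue_measure _)%E.
by apply/seteqP; split => x /=;
  rewrite !in_itv /= ltr_pdivrMr// ler_pdivlMr// /f ![k * x]mulrC.
Qed.

(** The substitution $x = k t$ holds for all nonnegative measurable functions,
    because Lebesgue measure is k times its own image under multiplication by
    k. *)
Lemma ge0_integral_scale {R : realType} (k : R) (k_gt0 : 0 < k) (D : set R)
    (f : R -> R) : measurable D -> measurable_fun setT f ->
    (forall x, 0 <= f x) ->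
  (\int[lebesgue_measure]_(x in D) (f x)%:E =
   k%:E * \int[lebesgue_measure]_(x in (fun x => (k * x)%R) @^-1` D)
             (f (k * x)%R)%:E)%E.
Proof.
move=> mD mf f0.
pose g : measurableTypeR R -> measurableTypeR R := fun x => k * x.
have mg : measurable_fun setT g by exact: measurable_funM.
pose fI := isMeasurableFun.Build _ _ _ _ _ mg.
pose G : {mfun _ >-> _} := HB.pack g fI.
pose kn : {nonneg R} := NngNum (ltW k_gt0).
have mfE : measurable_fun D (EFin \o f).
  by apply/measurable_EFinP; exact: measurable_funTS.
rewrite (eq_measure_integral (mscale kn (pushforward lebesgue_measure G)));
  last by move=> A mA _; exact: lebesgue_measureZ.
rewrite ge0_integral_mscale//; last by move=> x _; rewrite lee_fin.
by rewrite (ge0_integral_pushforward mg)// => x _; rewrite lee_fin.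
Qed.

(** The fundamental theorem of calculus with its continuity conditions at the
    end points replaced by differentiability on the closed interval. *)
Lemma integral_is_derive {R : realType} (f F : R -> R) (a b : R) : a < b ->
    (forall x, a <= x <= b -> is_derive x 1 F (f x)) ->
    (forall x, a <= x <= b -> derivable f x 1) ->
  (\int[lebesgue_measure]_(x in `[a, b]) (f x)%:E = (F b - F a)%:E)%E.
Proof.
move=> ab dF df; have dF1 x : a <= x <= b -> {for x, continuous F}.
  move=> /dF[dFx _]; apply: differentiable_continuous.
  exact/derivable1_diffP.
rewrite EFinB; apply: continuous_FTC2 => //.
- by apply: derivable_within_continuous => x; rewrite in_itv/= => /df.
- split=> [x||].
  + by rewrite in_itv/= => /andP[/ltW ax /ltW xb]; case: (dF x _); rewrite ?ax.
  + by apply: cvg_at_right_filter; apply: dF1; rewrite lexx ltW.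
  + by apply: cvg_at_left_filter; apply: dF1; rewrite lexx ltW.
- move=> x; rewrite in_itv/= => /andP[/ltW ax /ltW xb].
  by have [|_ <-] := dF x _; rewrite ?ax// derive1E.
Qed.

(** A nonnegative function with zero integral vanishes almost everywhere. *)
Lemma integral_gt0 {R : realType} (D : set R) (f : R -> R) :
  measurable D -> measurable_fun D f -> (0 < lebesgue_measure D)%E ->
  (forall x, D x -> 0 < f x) ->
  (0 < \int[lebesgue_measure]_(x in D) (f x)%:E)%E.
Proof.
move=> mD mf D0 f0; rewrite lt0e integral_ge0 ?andbT; last first.
  by move=> x /f0 fx; rewrite lee_fin ltW.
apply/eqP => If0.
have : (\int[lebesgue_measure]_(x in D) `|(f x)%:E| = 0)%E.
  rewrite -If0; apply: eq_integral => x; rewrite inE => /f0 fx.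
  by rewrite gee0_abs ?lee_fin ?ltW.
move/(ae_eq_integral_abs lebesgue_measure mD (f := EFin \o f)) => -[].
  exact/measurable_EFinP.
move=> N [mN N0 DN].
have : (lebesgue_measure D <= lebesgue_measure N)%E.
  apply: le_measure; rewrite ?inE// => x Dx; apply: DN => /= /(_ Dx) [] fx.
  by have := f0 _ Dx; rewrite fx ltxx.
by rewrite N0 leNgt D0.
Qed.

Lemma Rintegral_gt0 {R : realType} (D : set R) (f : R -> R) :
  measurable D -> lebesgue_measure.-integrable D (EFin \o f) ->
  (0 < lebesgue_measure D)%E -> (forall x, D x -> 0 < f x) ->
  0 < \int[lebesgue_measure]_(x in D) f x.
Proof.
move=> mD intf D0 f0; rewrite -lte_fin fineK; last exact: integrable_fin_num.
apply: integral_gt0 => //.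
by apply/measurable_EFinP; exact: measurable_int intf.
Qed.

Lemma Rintegral_itv_split {R : realType} (f : R -> R) (y : R) (b : itv_bound R) :
  0 <= y -> (BRight y <= b)%O ->
  lebesgue_measure.-integrable [set` Interval (BRight 0) b] (EFin \o f) ->
  \int[lebesgue_measure]_(x in [set` Interval (BRight 0) b]) f x =
  \int[lebesgue_measure]_(x in `]0, y]) f x +
  \int[lebesgue_measure]_(x in [set` Interval (BRight y) b]) f x.
Proof.
move=> y0 yb intf.
have H : [set` Interval (BRight 0) b] =
    `]0, y]%classic `|` [set` Interval (BRight y) b].
  by rewrite -itv_bndbnd_setU.
rewrite H Rintegral_setU//; first by rewrite -H.
apply/disj_setPLR => x /=; rewrite !itv_boundlr/= => /andP[_ xy].
by move=> /andP[+ _]; move: xy; rewrite !bnd_simp => xy; rewrite ltNge xy.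
Qed.

(** * The gamma function *)

Lemma measurable_gamma_integrand {R : realType} (a : R) :
  measurable_fun setT (fun x : R => x `^ (a - 1) * expR (- x)).
Proof.
apply: measurable_funM; first exact: measurable_powR.
by apply: measurableT_comp => //; exact: measurableT_comp.
Qed.

Lemma is_derive_ratio {R : realType} (x : R) : 0 < x ->
  is_derive x 1 (fun y : R => 1 - (1 + y)^-1) ((1 + x) ^- 2).
Proof.
move=> x0.
have x1 : 1 + x != 0 by rewrite gt_eqF// ltr_wpDl.
have H : is_derive x 1 (fun y : R => (1 + y)^-1)
    (- (1 + x) ^- 2 *: (0 + 1 : R)).
  by apply: is_deriveV.
apply: is_derive_eq.
by rewrite /GRing.scale /= !(add0r, addr0, mulr1, mul1r, sub0r) opprK.
Qed.

(** From $1 + x \le (a+1)(1 + x/(a+1)) \le (a+1) e^{x/(a+1)}$ raised to the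
    power $a + 1$. The right-hand side has an elementary antiderivative. *)
Lemma gamma_integrand_le {R : realType} (a x : R) : 0 < a -> 0 < x ->
  x `^ (a - 1) * expR (- x) <=
  (a + 1) `^ (a + 1) * (x `^ (a - 1) * ((1 + x) `^ (a + 1))^-1).
Proof.
move=> a0 x0; rewrite mulrCA ler_wpM2l ?powR_ge0//.
have a1 : 0 < a + 1 by rewrite addr_gt0.
have x1 : 0 < 1 + x by rewrite addr_gt0.
rewrite expRN ler_pdivlMr ?powR_gt0// mulrC ler_pdivrMr ?expR_gt0//.
have -> : expR x = expR (x / (a + 1)) `^ (a + 1).
  by rewrite -expRM divfK// gt_eqF.
rewrite -powRM ?expR_ge0 ?(ltW a1)//.
apply: ge0_ler_powR;
  rewrite ?nnegrE ?(ltW a1) ?(ltW x1) ?mulr_ge0 ?expR_ge0 ?(ltW a1)//.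
apply: (@le_trans _ _ ((a + 1) * (1 + x / (a + 1)))).
  by rewrite mulrDr mulr1 mulrCA divff ?gt_eqF// mulr1 lerD2r lerDr ltW.
by rewrite ler_wpM2l ?(ltW a1)// expR_ge1Dx.
Qed.

(** Here $1 - 1/(1+y) = y/(1+y)$, so the antiderivative stays in $[0, 1]$ on
    the half-line, which bounds the integral for every $a > 0$ at once. *)
Lemma is_derive_ratio_powR {R : realType} (a x : R) : 0 < x ->
  is_derive x 1 (fun y : R => (1 - (1 + y)^-1) `^ a)
    (a * (x `^ (a - 1) * ((1 + x) `^ (a + 1))^-1)).
Proof.
move=> x0.
have x1 : 0 < 1 + x by rewrite addr_gt0.
have gE : 1 - (1 + x)^-1 = x / (1 + x) by field; rewrite gt_eqF.
have g0 : 0 < 1 - (1 + x)^-1 by rewrite gE divr_gt0.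
have H1 := is_derive1_powR a g0.
have H2 := is_derive_ratio x x0.
have := @is_derive1_comp R (@powR R ^~ a) (fun y : R => 1 - (1 + y)^-1) _ _ _
  H1 H2.
move/is_derive_eq; apply.
rewrite gE -mulrA; congr (_ * _).
rewrite powRM ?(ltW x0) ?invr_ge0 ?(ltW x1)// -mulrA; congr (_ * _).
rewrite -powR_inv1 ?(ltW x1)// -powRrM mulN1r opprB.
rewrite -powR_invn ?(ltW x1)// -powRN -powRD; last first.
  by rewrite (gt_eqF x1) implybT.
by congr (_ `^ _); ring.
Qed.

Lemma derivable_powR_ratio {R : realType} (a b x : R) : 0 < x ->
  derivable (fun y : R => y `^ a * ((1 + y) `^ b)^-1) x 1.
Proof.
move=> x0; have x1 : 0 < 1 + x by rewrite addr_gt0.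
have H1 := is_derive1_powR a x0.
have H2 : is_derive (1 + x) 1 (@powR R ^~ b) (b * (1 + x) `^ (b - 1)).
  exact: is_derive1_powR.
have H3 : is_derive x 1 (fun y : R => 1 + y) (0 + 1) by apply: is_deriveD.
have H4 := @is_derive1_comp R (@powR R ^~ b) (fun y : R => 1 + y) _ _ _ H2 H3.
have H5 : is_derive x 1 (fun y : R => ((1 + y) `^ b)^-1)
   (- ((1 + x) `^ b) ^- 2 *: (b * (1 + x) `^ (b - 1) * (0 + 1))).
  by apply: is_deriveV; rewrite ?gt_eqF ?powR_gt0.
apply: derivableM; exact: ex_derive.
Qed.

(** The integrand may be unbounded at 0, so the half-line is exhausted by
    compact intervals, on which the integrals are bounded uniformly by the
    antiderivative of is_derive_ratio_powR. *)
Lemma integrable_gamma_integrand {R : realType} (a : R) : 0 < a ->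
  lebesgue_measure.-integrable `]0, +oo[
    (fun x : R => (x `^ (a - 1) * expR (- x))%:E).
Proof.
move=> a0.
pose f (x : R) := x `^ (a - 1) * expR (- x).
(* n.+2 rather than n.+1, so that no interval of the exhaustion is a point *)
pose F n : set R := `[(n.+2%:R)^-1, n.+2%:R]%classic.
have f0 x : 0 <= f x by rewrite mulr_ge0 ?powR_ge0 ?expR_ge0.
have mf : measurable_fun setT f by exact: measurable_gamma_integrand.
have FU : \bigcup_n F n = `]0, +oo[%classic.
  apply/seteqP; split => [x [n _]|x]; rewrite /F /= !in_itv/= ?andbT.
    by move=> /andP[+ _]; apply: lt_le_trans; rewrite invr_gt0.
  move=> x0; pose n := Num.truncn (Num.max x x^-1).
  have xn : Num.max x x^-1 < n.+2%:R.
    rewrite (lt_trans (truncnS_gt _))// ltr_nat//.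
  move: xn; rewrite gt_max => /andP[xn xVn]; exists n => //=; rewrite in_itv/=.
  by rewrite (ltW xn) andbT invf_ple ?posrE// ltW.
apply/integrableP; split; first exact/measurable_EFinP/measurable_funTS.
under eq_integral do rewrite gee0_abs ?lee_fin ?f0//.
rewrite -FU.
(* the factor / a makes C times the derivative of (x / (1 + x)) `^ a the bound
   of gamma_integrand_le *)
pose C := (a + 1) `^ (a + 1) / a.
have lim : (\int[lebesgue_measure]_(x in F i) (f x)%:E @[i --> \oo] -->
    \int[lebesgue_measure]_(x in \bigcup_i F i) (f x)%:E)%E.
  apply: ge0_nondecreasing_set_cvg_integral => //.
  - apply/nondecreasing_seqP => n; apply/subsetPset => x.
    rewrite /F /= !in_itv/=.
    move=> /andP[nx xn]; rewrite (le_trans _ nx) ?(le_trans xn) ?ler_nat//.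
    by rewrite lef_pV2 ?posrE// ler_nat.
  - by move=> i; exact: measurable_itv.
  - by move=> i; exact/measurable_EFinP/measurable_funTS.
  - by move=> i x _; rewrite lee_fin.
apply: (@le_lt_trans _ _ C%:E); last exact: ltry.
rewrite -(cvg_lim _ lim)//; apply: lime_le.
  by apply/cvg_ex; eexists; exact: lim.
apply: nearW => n.
pose g (x : R) := x `^ (a - 1) * ((1 + x) `^ (a + 1))^-1.
have n0 : 0 < n.+2%:R^-1 :> R by rewrite invr_gt0.
apply: (@le_trans _ _ (\int[lebesgue_measure]_(x in F n) (C * (a * g x))%:E)%E).
  apply: ge0_le_integral => //.
  - exact: measurable_itv.
  - by move=> x _; rewrite lee_fin.
  - exact/measurable_EFinP/measurable_funTS.
  - apply/measurable_EFinP/measurable_funTS.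
    do 2 apply: measurable_funM => //.
    apply: measurable_funM; first exact: measurable_powR.
    under eq_fun do rewrite -powRN.
    apply: (measurableT_comp (f := @powR R ^~ (- (a + 1)))).
      exact: measurable_powR.
    exact: measurable_funD.
  - move=> x; rewrite /F /= in_itv/= => /andP[nx _]; rewrite lee_fin.
    rewrite /C mulrA divfK ?gt_eqF// gamma_integrand_le//.
    exact: lt_le_trans nx.
pose G (y : R) := C * (1 - (1 + y)^-1) `^ a.
rewrite [leLHS](_ : _ = (G n.+2%:R - G n.+2%:R^-1)%:E); last first.
  apply: integral_is_derive.
  - apply: (@le_lt_trans _ _ 1); last by rewrite ltr1n.
    by rewrite invf_le1// ler1n.
  - move=> x /andP[nx _]; have x0 := lt_le_trans n0 nx.
    have H := is_derive_ratio_powR a x x0.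
    by apply: is_derive_eq.
  - move=> x /andP[nx _]; have x0 := lt_le_trans n0 nx.
    do 2 apply: derivableM => //; exact: derivable_powR_ratio.
rewrite lee_fin -mulrBr -[leRHS]mulr1 ler_wpM2l//.
  by rewrite /C divr_ge0 ?powR_ge0// ltW.
rewrite lerBlDr (@le_trans _ _ 1) ?lerDl ?powR_ge0//.
apply: (@le_trans _ _ (1 `^ a)); last by rewrite powR1.
apply: ge0_ler_powR; rewrite ?nnegrE ?ltW//.
  by rewrite subr_gt0 invf_lt1 ?ltrDl ?addr_gt0.
Qed.

Lemma gamma_funE {R : realType} (a : R) : 0 < a ->
  (\int[lebesgue_measure]_(x in `]0%R, +oo[) (x `^ (a - 1) * expR (- x))%:E =
   (gamma_fun a)%:E)%E.
Proof.
move=> a0; rewrite /gamma_fun /Rintegral fineK//.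
exact: integrable_fin_num (integrable_gamma_integrand a a0).
Qed.

Lemma gamma_fun_gt0 {R : realType} (a : R) : 0 < a -> 0 < gamma_fun a.
Proof.
move=> a0; rewrite -lte_fin -gamma_funE//; apply: integral_gt0 => //.
- by apply: measurable_funTS; exact: measurable_gamma_integrand.
- by rewrite lebesgue_measure_itv /= ltry/= ?sube0 ltry.
- move=> x; rewrite /= in_itv/= andbT => x0.
  by rewrite mulr_gt0 ?powR_gt0 ?expR_gt0.
Qed.

(** * Gamma distributions *)

Lemma measurable_powR_expR {R : realType} (a b : R) :
  measurable_fun setT (fun x : R => x `^ a * expR (- (x / b))).
Proof.
apply: measurable_funM; first exact: measurable_powR.
apply: measurableT_comp => //; apply: measurableT_comp => //.
exact: measurable_funM.
Qed.

Lemma measurable_gamma_pdf {R : realType} (a b : R) :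
  measurable_fun setT (gamma_pdf a b).
Proof.
apply/measurable_restrict => //; apply: measurable_funTS.
under eq_fun do rewrite -mulrA.
by apply: measurable_funM => //; exact: measurable_powR_expR.
Qed.

Lemma gamma_pdfE {R : realType} (a b x : R) : 0 < x ->
  gamma_pdf a b x =
  (b `^ a * gamma_fun a)^-1 * x `^ (a - 1) * expR (- (x / b)).
Proof. by move=> x0; rewrite /gamma_pdf patchE mem_set// /= in_itv/= x0. Qed.

Lemma gamma_pdf_npos {R : realType} (a b x : R) : x <= 0 -> gamma_pdf a b x = 0.
Proof.
move=> x0; rewrite /gamma_pdf patchE memNset//= in_itv/= andbT.
by apply/negP; rewrite -leNgt.
Qed.

Lemma gamma_pdf_gt0 {R : realType} (a b x : R) : 0 < a -> 0 < b -> 0 < x ->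
  0 < gamma_pdf a b x.
Proof.
move=> a0 b0 x0; rewrite gamma_pdfE// !mulr_gt0 ?expR_gt0 ?powR_gt0//.
by rewrite invr_gt0 mulr_gt0 ?powR_gt0 ?gamma_fun_gt0.
Qed.

Lemma gamma_pdf_ge0 {R : realType} (a b x : R) : 0 < a -> 0 < b ->
  0 <= gamma_pdf a b x.
Proof.
move=> a0 b0; have [x0|x0] := ltP 0 x; first exact/ltW/gamma_pdf_gt0.
by rewrite gamma_pdf_npos.
Qed.

(** If a variable has density gamma_pdf a b, its quotient by k has the
    density on the left. *)
Lemma gamma_pdf_scale {R : realType} (a b k x : R) : 0 < a -> 0 < b -> 0 < k ->
  k * gamma_pdf a b (k * x) = gamma_pdf a (b / k) x.
Proof.
move=> a0 b0 k0; have [x0|x0] := ltP 0 x; last first.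
  by rewrite !gamma_pdf_npos ?mulr0// pmulr_rle0.
rewrite !gamma_pdfE ?mulr_gt0//.
have -> : k * x / b = x / (b / k) by rewrite invf_div; ring.
rewrite !mulrA; congr (_ * _).
rewrite !powRM ?invr_ge0 ?(ltW k0) ?(ltW b0) ?(ltW x0)// mulrA; congr (_ * _).
rewrite -(powR_inv1 (ltW k0)) -powRrM mulN1r powRN.
rewrite powRB ?(gt_eqF k0) ?implybT//.
rewrite powRr1 ?(ltW k0)//.
field.
by rewrite !gt_eqF ?powR_gt0 ?gamma_fun_gt0.
Qed.

Lemma integral_gamma_pdf {R : realType} (a b : R) : 0 < a -> 0 < b ->
  (\int[lebesgue_measure]_x (gamma_pdf a b x)%:E = 1)%E.
Proof.
move=> a0 b0.
rewrite (@ge0_integral_scale _ b)//; [|exact: measurable_gamma_pdf|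
  by move=> x; exact: gamma_pdf_ge0].
rewrite preimage_setT -ge0_integralZl//; last 3 first.
- apply/measurable_EFinP; apply: measurableT_comp.
    exact: measurable_gamma_pdf.
  exact: measurable_funM.
- by move=> x _; rewrite lee_fin gamma_pdf_ge0.
- by rewrite lee_fin ltW.
under eq_integral do rewrite -EFinM gamma_pdf_scale// divff ?gt_eqF//.
transitivity ((gamma_fun a)^-1%:E * \int[lebesgue_measure]_(x in `]0%R, +oo[)
   (x `^ (a - 1) * expR (- x))%:E)%E.
  rewrite -ge0_integralZl//; last 3 first.
  - apply/measurable_EFinP; apply: measurable_funTS.
    exact: measurable_gamma_integrand.
  - by move=> x _; rewrite lee_fin mulr_ge0 ?powR_ge0 ?expR_ge0.
  - by rewrite lee_fin invr_ge0 ltW ?gamma_fun_gt0.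
  rewrite [RHS]integral_mkcond; apply: eq_integral => x _.
  rewrite /gamma_pdf !patchE; case: ifPn => // _.
  by rewrite powR1 mul1r divr1 -EFinM mulrA.
by rewrite gamma_funE// -EFinM mulVf// gt_eqF// gamma_fun_gt0.
Qed.

Lemma integrable_gamma_pdf {R : realType} (a b : R) (D : set R) :
  0 < a -> 0 < b -> measurable D ->
  lebesgue_measure.-integrable D (EFin \o gamma_pdf a b).
Proof.
move=> a0 b0 mD; apply: (@integrableS _ _ _ _ setT) => //.
apply/integrableP; split.
  by apply/measurable_EFinP; exact: measurable_gamma_pdf.
under eq_integral do rewrite /= ger0_norm ?gamma_pdf_ge0//.
by rewrite integral_gamma_pdf// ltry.
Qed.

Lemma Rintegral_gamma_pdf {R : realType} (a b : R) : 0 < a -> 0 < b ->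
  \int[lebesgue_measure]_(t in `]0, +oo[) gamma_pdf a b t = 1.
Proof.
move=> a0 b0; rewrite /Rintegral (_ : (\int[_]_(_ in _) _)%E = 1%E)//.
rewrite -(@integral_gamma_pdf _ a b)//.
rewrite integral_mkcond; apply: eq_integral => t _.
rewrite patchE; case: ifPn => // /negP; rewrite inE/= in_itv/= andbT => /negP.
by rewrite -leNgt => /gamma_pdf_npos ->.
Qed.

Lemma EFin_gamma_cdf {R : realType} (a b x : R) : 0 < a -> 0 < b ->
  (gamma_cdf a b x)%:E = 
  (\int[lebesgue_measure]_(t in `]0%R, x]) (gamma_pdf a b t)%:E)%E.
Proof.
move=> a0 b0; rewrite /gamma_cdf /gamma_prob.
rewrite fineK; last first.
  exact: integrable_fin_num (integrable_gamma_pdf a b _ a0 b0 _).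
rewrite [LHS]integral_mkcond [RHS]integral_mkcond; apply: eq_integral => t _.
rewrite !patchE.
have [t0|t0] := ltP 0 t.
  by congr (if _ then _ else _); apply/idP/idP; rewrite !inE/= !in_itv/= t0.
by rewrite gamma_pdf_npos//; case: ifP; case: ifP.
Qed.

Lemma gamma_cdfE {R : realType} (a b x : R) : 0 < a -> 0 < b ->
  gamma_cdf a b x = \int[lebesgue_measure]_(t in `]0, x]) gamma_pdf a b t.
Proof. by move=> a0 b0; rewrite /Rintegral -EFin_gamma_cdf. Qed.

Lemma gamma_cdf_scale {R : realType} (a b k x : R) : 0 < a -> 0 < b -> 0 < k ->
  gamma_cdf a b (k * x) = gamma_cdf a (b / k) x.
Proof.
move=> a0 b0 k0; congr fine; rewrite /gamma_prob.
rewrite (@ge0_integral_scale _ k)//; [|exact: measurable_gamma_pdf|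
  by move=> ?; exact: gamma_pdf_ge0].
have -> : (fun y : R => k * y) @^-1` `]-oo, (k * x)] = `]-oo, x]%classic.
  by apply/seteqP; split => y /=; rewrite !in_itv/= ler_pM2l.
rewrite -ge0_integralZl//; last 3 first.
- apply/measurable_EFinP/measurable_funTS; apply: measurableT_comp.
    exact: measurable_gamma_pdf.
  exact: measurable_funM.
- by move=> y _; rewrite lee_fin gamma_pdf_ge0.
- by rewrite lee_fin ltW.
by apply: eq_integral => y _; rewrite -EFinM gamma_pdf_scale.
Qed.

Lemma gamma_cdf_npos {R : realType} (a b x : R) : 0 < a -> 0 < b -> x <= 0 ->
  gamma_cdf a b x = 0.
Proof.
move=> a0 b0 x0; rewrite gamma_cdfE// set_itv_ge ?Rintegral_set0//.
by rewrite bnd_simp -leNgt.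
Qed.

Lemma gamma_cdf_lt {R : realType} (a b x y : R) : 0 < a -> 0 < b ->
  0 <= x -> x < y -> gamma_cdf a b x < gamma_cdf a b y.
Proof.
move=> a0 b0 x0 xy; rewrite !gamma_cdfE//.
rewrite (@Rintegral_itv_split _ _ x (BRight y)) ?bnd_simp ?(ltW xy)//;
  last exact: integrable_gamma_pdf.
rewrite ltrDl; apply: Rintegral_gt0 => //; first exact: integrable_gamma_pdf.
  by rewrite lebesgue_measure_itv/= lte_fin xy -EFinB lte_fin subr_gt0.
move=> t; rewrite /= in_itv/= => /andP[xt _]; apply: gamma_pdf_gt0 => //.
exact: le_lt_trans xt.
Qed.

Lemma gamma_cdf_ltE {R : realType} (a b x y : R) : 0 < a -> 0 < b ->
  0 <= x -> 0 <= y -> (gamma_cdf a b x < gamma_cdf a b y) = (x < y).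
Proof.
move=> a0 b0 x0 y0; apply/idP/idP; last exact: gamma_cdf_lt.
apply: contraTT; rewrite -!leNgt le_eqVlt => /predU1P[->//|yx].
by apply/ltW/gamma_cdf_lt.
Qed.

(** The intermediate value theorem between 0 and a point where the
    distribution function, which tends to 1, exceeds p. *)
Lemma gamma_cdf_quantile {R : realType} (a b p : R) : 0 < a -> 0 < b ->
  0 < p < 1 -> exists x, gamma_cdf a b x = p.
Proof.
move=> a0 b0 /andP[p0 p1].
have [n pn] : exists n : nat, p < gamma_cdf a b n%:R.
  have lim : (\int[lebesgue_measure]_(x in `]0%R, i%:R]%classic)
        (gamma_pdf a b x)%:E @[i --> \oo] -->
      \int[lebesgue_measure]_(x in \bigcup_i `]0%R, i%:R]%classic)
        (gamma_pdf a b x)%:E)%E.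
    apply: ge0_nondecreasing_set_cvg_integral => //.
    - apply/nondecreasing_seqP => n; apply/subsetPset => x /=.
      rewrite !in_itv/= => /andP[-> xn]/=; rewrite (le_trans xn) ?ler_nat//.
    - move=> i; apply/measurable_EFinP/measurable_funTS.
      exact: measurable_gamma_pdf.
    - by move=> i x _; rewrite lee_fin gamma_pdf_ge0.
  have U1 : (\int[lebesgue_measure]_(x in \bigcup_i `]0%R, i%:R]%classic)
        (gamma_pdf a b x)%:E = 1)%E.
    rewrite -(@integral_gamma_pdf _ a b)// integral_mkcond.
    apply: eq_integral => t _; rewrite patchE; case: ifPn => // /negP H.
    rewrite gamma_pdf_npos// leNgt; apply/negP => t0; apply: H.
    rewrite inE; exists (Num.truncn t).+1 => //=.
    by rewrite in_itv/= t0 ltW ?truncnS_gt.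
  rewrite U1 in lim.
  apply: contrapT => /forallNP H.
  suff : (1 <= p%:E)%E by rewrite lee_fin leNgt p1.
  rewrite -(cvg_lim _ lim)//; apply: lime_le.
    by apply/cvg_ex; eexists; exact: lim.
  apply: nearW => i; rewrite -EFin_gamma_cdf// lee_fin leNgt; apply/negP.
  exact: H.
(* the density may be unbounded near 0, but an indefinite integral is
   continuous as soon as the integrand is integrable *)
have cF : {within `[0, n%:R], continuous (fun x => gamma_cdf a b x)}.
  rewrite (_ : (fun x => _) = fun x =>
     parameterized_integral lebesgue_measure 0 x (gamma_pdf a b)).
    apply: parameterized_integral_continuous => //.
    exact: integrable_gamma_pdf.
  apply/funext => x; rewrite gamma_cdfE// /parameterized_integral.
  rewrite Rintegral_itv_obnd_cbnd//.
  exact: integrable_gamma_pdf.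
have [||x _ <-] := @IVT R _ 0 n%:R p _ cF; [exact: ler0n| |by exists x].
by rewrite ge_min le_max (gamma_cdf_npos a b 0)// (ltW p0) (ltW pn) orbT.
Qed.

(** * Single crossing of gamma distribution functions *)

(** The cumulative form of a sign-change argument. If $\{h \le 0\}$ is an
    interval and the integral of h vanishes on $]0, x]$, then h is nonpositive
    somewhere in $]0, x]$. Were the integral positive on $]0, y]$, h would be
    positive somewhere in $]x, y]$ and hence nonnegative beyond y, and its
    total integral could not be 0. *)
Lemma single_crossing {R : realType} (h : R -> R) (x y : R) :
  lebesgue_measure.-integrable `]0, +oo[ (EFin \o h) ->
  (forall u v w, 0 < u -> u < v -> v < w -> h u <= 0 -> h w <= 0 -> h v <= 0) ->
  \int[lebesgue_measure]_(t in `]0, +oo[) h t = 0 ->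
  0 < x -> x < y ->
  \int[lebesgue_measure]_(t in `]0, x]) h t = 0 ->
  \int[lebesgue_measure]_(t in `]0, y]) h t <= 0.
Proof.
move=> inth hconv h0 x0 xy hx0; rewrite leNgt; apply/negP => hy0.
have ihy : lebesgue_measure.-integrable `]0, y] (EFin \o h).
  by apply: integrableS inth => // t/=; rewrite !in_itv/= andbT => /andP[].
(* h cannot be positive on all of ]0, x], nor nonpositive on all of ]x, y] *)
have [u [/andP[u0 ux] hu]] : exists u, 0 < u <= x /\ h u <= 0.
  apply: contrapT => /forallNP H.
  suff : 0 < \int[lebesgue_measure]_(t in `]0, x]) h t by rewrite hx0 ltxx.
  apply: Rintegral_gt0 => //.
  - apply: integrableS inth => // t/=; rewrite !in_itv/= andbT.
    by move=> /andP[].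
  - by rewrite lebesgue_measure_itv/= lte_fin x0 sube0 lte_fin.
  - move=> t; rewrite /= in_itv/= => tx; rewrite ltNge; apply/negP => ht.
    exact: (H t).
have [v [/andP[xv vy] hv]] : exists v, x < v <= y /\ 0 < h v.
  apply: contrapT => /forallNP H; move: hy0.
  rewrite (@Rintegral_itv_split _ _ x) ?(ltW x0) ?bnd_simp ?ltW//.
  rewrite hx0 add0r ltNge => /negP; apply.
  rewrite -oppr_ge0 -mulN1r -RintegralZl//; last first.
    apply: integrableS ihy => // t/=.
    by rewrite !in_itv/= => /andP[/(lt_trans x0)-> ->].
  apply: Rintegral_ge0 => t /=; rewrite in_itv/= => txy.
  rewrite mulN1r oppr_ge0 leNgt; apply/negP => ht.
  exact: (H t).
(* a point w > y with h w < 0 would put v between two points of the set *)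
have hw w : y < w -> 0 <= h w.
  move=> yw; rewrite leNgt; apply/negP => /ltW hw.
  have := hconv u v w u0 (le_lt_trans ux xv) (le_lt_trans vy yw) hu hw.
  by rewrite leNgt hv.
move: h0; rewrite (@Rintegral_itv_split _ _ y) ?(ltW (lt_trans x0 xy))// => h0.
have : 0 <= \int[lebesgue_measure]_(x in `]y, +oo[) h x.
  by apply: Rintegral_ge0 => t /=; rewrite in_itv/= andbT => /hw.
by move: h0 hy0; lra.
Qed.

(** Normalizing constants only shift the log-density, so no value of the gamma
    function is needed to compare two gamma densities. *)
Lemma gamma_pdf_expR {R : realType} (a b : R) : 0 < a -> 0 < b ->
  exists c, forall x, 0 < x ->
    gamma_pdf a b x = expR (c + (a - 1) * ln x - x / b).
Proof.
move=> a0 b0; exists (ln (b `^ a * gamma_fun a)^-1) => x x0.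
rewrite gamma_pdfE// 2!expRD lnK ?posrE ?invr_gt0; last first.
  by rewrite mulr_gt0 ?powR_gt0 ?gamma_fun_gt0.
by rewrite /powR (gt_eqF x0).
Qed.

Lemma ln_le_tangent {R : realType} (x y : R) : 0 < x -> 0 < y ->
  ln x <= ln y + (x / y - 1).
Proof.
move=> x0 y0; rewrite -lerBlDl -ln_div ?posrE//.
rewrite -ler_expR lnK ?posrE ?divr_gt0//.
by apply: le_trans (expR_ge1Dx _); rewrite addrC subrK.
Qed.

(** The difference of the log-densities is an affine function minus
    $(a_2 - a_1) \ln$, hence convex; replacing $\ln$ by its tangent at v gives
    an affine function that is nonpositive at u and w, hence at v. *)
Lemma gamma_pdf_le_interval {R : realType} (a1 b1 a2 b2 u v w : R) :
  0 < a1 -> a1 < a2 -> 0 < b1 -> 0 < b2 -> 0 < u -> u < v -> v < w ->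
  gamma_pdf a1 b1 u <= gamma_pdf a2 b2 u ->
  gamma_pdf a1 b1 w <= gamma_pdf a2 b2 w ->
  gamma_pdf a1 b1 v <= gamma_pdf a2 b2 v.
Proof.
move=> a10 a12 b10 b20 u0 uv vw.
have a20 := lt_trans a10 a12; have v0 := lt_trans u0 uv.
have w0 := lt_trans v0 vw.
have [c1 f1E] := gamma_pdf_expR a1 b1 a10 b10.
have [c2 f2E] := gamma_pdf_expR a2 b2 a20 b20.
rewrite !f1E// !f2E// !ler_expR.
have := ln_le_tangent u v u0 v0; have := ln_le_tangent w v w0 v0.
set iv := v^-1; set i1 := b1^-1; set i2 := b2^-1 => lw lu.
(* A lies below the difference of the two log-densities, touches it at v, and
   is affine *)
pose A s := c1 - c2 + s * (i2 - i1) - (a2 - a1) * (ln v + (s * iv - 1)).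
have A_le s : 0 < s -> ln s <= ln v + (s * iv - 1) ->
   c1 + (a1 - 1) * ln s - s * i1 <= c2 + (a2 - 1) * ln s - s * i2 -> A s <= 0.
  move=> s0 ls H.
  have : (a2 - a1) * ln s <= (a2 - a1) * (ln v + (s * iv - 1)).
    by rewrite ler_wpM2l// subr_ge0 ltW.
  by rewrite /A; move: H; lra.
move=> /(A_le _ u0 lu) Au /(A_le _ w0 lw) Aw.
have AE : A v * (w - u) = A u * (w - v) + A w * (v - u). by rewrite /A; ring.
have wu : 0 < w - u by rewrite subr_gt0 (lt_trans uv).
have Av : A v <= 0.
  rewrite -(pmulr_lle0 _ wu) AE -[leRHS]addr0.
  apply: lerD; apply: mulr_le0_ge0 => //.
    by rewrite subr_ge0 ltW.
  by rewrite subr_ge0 ltW.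
by move: Av; rewrite /A mulfV ?gt_eqF//; lra.
Qed.

(** After a common point the variable of smaller shape parameter has the
    heavier tail, whatever the scales. *)
Lemma gamma_cdf_single_crossing {R : realType} (a1 b1 a2 b2 x y : R) :
  0 < a1 -> a1 < a2 -> 0 < b1 -> 0 < b2 -> 0 < x -> x < y ->
  gamma_cdf a1 b1 x = gamma_cdf a2 b2 x ->
  gamma_cdf a1 b1 y <= gamma_cdf a2 b2 y.
Proof.
move=> a10 a12 b10 b20 x0 xy; have a20 := lt_trans a10 a12.
pose h t := gamma_pdf a1 b1 t - gamma_pdf a2 b2 t.
have hE (D : set (measurableTypeR R)) : measurable D ->
    lebesgue_measure.-integrable D (EFin \o h) /\
    \int[lebesgue_measure]_(t in D) h t =
    \int[lebesgue_measure]_(t in D) gamma_pdf a1 b1 t -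
    \int[lebesgue_measure]_(t in D) gamma_pdf a2 b2 t.
  move=> mD; have i1 := integrable_gamma_pdf a1 b1 _ a10 b10 mD.
  have i2 := integrable_gamma_pdf a2 b2 _ a20 b20 mD.
  split; last exact: RintegralB.
  have := integrableB mD i1 i2.
  by apply: eq_integrable => // t _; rewrite /= EFinB.
rewrite (gamma_cdfE a1 b1 x a10 b10) (gamma_cdfE a2 b2 x a20 b20) => Fx.
rewrite (gamma_cdfE a1 b1 y a10 b10) (gamma_cdfE a2 b2 y a20 b20) -subr_le0.
have [|_ <-] := hE `]0, y]%classic; first exact: measurable_itv.
apply: (@single_crossing _ h x _ _ _ _ x0 xy).
- by apply: (hE `]0, +oo[%classic _).1; exact: measurable_itv.
- move=> u v w u0 uv vw; rewrite /h !subr_le0; exact: gamma_pdf_le_interval.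
- have [|_ ->] := hE `]0, +oo[%classic; first exact: measurable_itv.
  by rewrite !Rintegral_gamma_pdf ?subrr.
- have [|_ ->] := hE `]0, x]%classic; first exact: measurable_itv.
  by rewrite Fx subrr.
Qed.

(** * Star order and reciprocals of quantiles *)

(** Gamma laws decrease in the star order as the shape grows: the ratio of the
    quantile functions, larger shape over smaller, is nonincreasing. The scales
    are free in gamma_cdf_single_crossing, so one of the laws may be rescaled
    until the distribution functions meet at the lower quantile. *)
Lemma gamma_quantile_ratio {R : realType} (a1 b1 a2 b2 x1 x2 y1 y2 : R) :
  0 < a1 -> a1 < a2 -> 0 < b1 -> 0 < b2 ->
  0 < x1 -> 0 < x2 -> 0 < y1 -> 0 < y2 -> x2 < y2 ->
  gamma_cdf a1 b1 x1 = gamma_cdf a2 b2 x2 ->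
  gamma_cdf a1 b1 y1 = gamma_cdf a2 b2 y2 ->
  y2 / y1 <= x2 / x1.
Proof.
move=> a10 a12 b10 b20 x10 x20 y10 y20 xy2 Fx Fy.
have a20 := lt_trans a10 a12.
(* dividing the first variable by k makes the distribution functions meet at
   x2 *)
pose k := x1 / x2; have k0 : 0 < k by rewrite divr_gt0.
have kx2 : k * x2 = x1 by rewrite divfK ?gt_eqF.
have Fkx2 : gamma_cdf a1 (b1 / k) x2 = gamma_cdf a2 b2 x2.
  by rewrite -(gamma_cdf_scale _ _ _ _ a10 b10 k0) kx2.
have bk0 : 0 < b1 / k by rewrite divr_gt0.
have := gamma_cdf_single_crossing _ _ _ _ _ _ a10 a12 bk0 b20 x20 xy2 Fkx2.
rewrite -(gamma_cdf_scale _ _ _ _ a10 b10 k0) -Fy leNgt.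
rewrite (gamma_cdf_ltE _ _ _ _ a10 b10 (ltW y10)
  (mulr_ge0 (ltW k0) (ltW y20))) -leNgt /k mulrAC (ler_pdivrMr _ _ x20) => ky2.
rewrite (ler_pdivrMr _ _ y10) mulrAC (ler_pdivlMr _ _ x10).
by rewrite mulrC [x2 * _]mulrC.
Qed.

(** Since $1/x_1 - 1/x_2 = (x_2/x_1 - 1)/x_2$, the claim compares the factors
    $x_2/x_1 - 1 \ge y_2/y_1 - 1$ and $1/x_2 > 1/y_2$. *)
Lemma reciprocal_spread {R : realFieldType} (x1 x2 y1 y2 : R) :
  0 < x1 -> x1 < x2 -> x2 < y2 -> 0 < y1 -> y2 / y1 <= x2 / x1 ->
  1 / x2 - 1 / y2 < 1 / x1 - 1 / y1.
Proof.
move=> x10 x12 xy2 y10 H.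
have x20 := lt_trans x10 x12; have y20 := lt_trans x20 xy2.
rewrite !div1r; suff : y1^-1 - y2^-1 < x1^-1 - x2^-1 by lra.
have -> : y1^-1 - y2^-1 = y2^-1 * (y2 / y1 - 1).
  by rewrite mulrBr mulr1 mulrA mulVf ?mul1r// gt_eqF.
have -> : x1^-1 - x2^-1 = x2^-1 * (x2 / x1 - 1).
  by rewrite mulrBr mulr1 mulrA mulVf ?mul1r// gt_eqF.
apply: (@le_lt_trans _ _ (y2^-1 * (x2 / x1 - 1))).
  by rewrite ler_wpM2l ?invr_ge0 ?(ltW y20)// lerD2r.
by rewrite ltr_pM2r ?ltf_pV2// subr_gt0 ltr_pdivlMr// mul1r.
Qed.

(** The first distribution function dominates at x1, which gives x1 < x2; the
    star order then carries the comparison to the upper quantiles, whichever of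
    y1 and y2 is larger. *)
Lemma gamma_reciprocal_spread {R : realType}
    (a1 b1 a2 b2 x x1 x2 y1 y2 p q : R) :
  0 < a1 -> a1 < a2 -> 0 < b1 -> 0 < b2 -> p < q ->
  0 < x1 /\ gamma_cdf a1 b1 x1 = p -> 0 < y1 /\ gamma_cdf a1 b1 y1 = q ->
  0 < x2 /\ gamma_cdf a2 b2 x2 = p -> 0 < y2 /\ gamma_cdf a2 b2 y2 = q ->
  0 <= x -> p < gamma_cdf a1 b1 x ->
  (forall y, 0 < y -> y < x -> gamma_cdf a2 b2 y < gamma_cdf a1 b1 y) ->
  1 / x2 - 1 / y2 < 1 / x1 - 1 / y1.
Proof.
move=> a10 a12 b10 b20 pq [x10 Fx1] [y10 Fy1] [x20 Fx2] [y20 Fy2] x0 px F12.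
have a20 := lt_trans a10 a12.
have x1x : x1 < x.
  by rewrite -(gamma_cdf_ltE _ _ _ _ a10 b10 (ltW x10) x0) Fx1.
have x12 : x1 < x2.
  rewrite -(gamma_cdf_ltE _ _ _ _ a20 b20 (ltW x10) (ltW x20)) Fx2 -Fx1.
  exact: F12.
have xy2 : x2 < y2.
  by rewrite -(gamma_cdf_ltE _ _ _ _ a20 b20 (ltW x20) (ltW y20)) Fx2 Fy2.
apply: (reciprocal_spread _ _ _ _ x10 x12 xy2 y10).
exact: (gamma_quantile_ratio _ _ _ _ _ _ _ _ a10 a12 b10 b20 x10 x20 y10 y20
  xy2 (etrans Fx1 (esym Fx2)) (etrans Fy1 (esym Fy2))).
Qed.

(** * Comparison of the two lengths *)

Lemma scaled_chi2_quantile {R : realType} (d : nat) (p : R) :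
  (0 < d)%N -> 0 < p < 1 ->
  0 < chi2_quantile d p / d%:R /\
  scaled_chi2_cdf d (chi2_quantile d p / d%:R) = p.
Proof.
move=> d0 p01; have dR0 : 0 < d%:R :> R by rewrite ltr0n.
have a0 : 0 < d%:R / 2 :> R by rewrite divr_gt0.
have b0 : 0 < 2 :> R by [].
have Fq : chi2_cdf d (chi2_quantile d p) = p.
  exact: (getPex (gamma_cdf_quantile _ _ _ a0 b0 p01)).
split; last first.
  rewrite /scaled_chi2_cdf -(gamma_cdf_scale _ _ _ _ a0 b0 dR0).
  rewrite [X in gamma_cdf _ _ X](_ : _ = chi2_quantile d p)//.
  by rewrite mulrC divfK// gt_eqF.
rewrite divr_gt0// ltNge; apply/negP => q0.
by move: Fq p01; rewrite /chi2_cdf gamma_cdf_npos// => <-; rewrite ltxx.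
Qed.

(** If no crossing point existed, the choice operator would return 0, where the
    distribution function vanishes; so a positive value comes from a genuine
    crossing point. *)
Lemma alpha_star_crossing {R : realType} (n : nat) : (2 <= n)%N ->
  0 < alpha_star n :> R -> exists2 x : R, cdf_crossing n x &
    alpha_star n = scaled_chi2_cdf n.-1 x.
Proof.
move=> n2 al0; exists (get [set x : R | cdf_crossing n x]) => //.
apply: (@getPex _ [set x : R | cdf_crossing n x]).
apply: contrapT => /forallNP H.
have g0 : get [set x : R | cdf_crossing n x] = 0 by exact: (xgetPN point H).
move: al0; rewrite /alpha_star g0 /scaled_chi2_cdf gamma_cdf_npos ?ltxx//.
  by rewrite divr_gt0// ltr0n -ltnS prednK// ltnW.
by rewrite divr_gt0// ltr0n -ltnS prednK// ltnW.
Qed.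

Lemma ci_avg_length_lt {R : realType} (sigma : R) (n : nat) (alpha : R) :
  0 < sigma -> (2 <= n)%N -> 0 < alpha -> alpha < 1 -> alpha < alpha_star n ->
  ci_avg_length sigma alpha n.+1 < ci_avg_length sigma alpha n.
Proof.
move=> s0 n2 al0 al1.
have n0 : (0 < n)%N := ltnW n2.
have n1 : (0 < n.-1)%N by rewrite -ltnS prednK.
have n1R : 0 < n.-1%:R :> R by rewrite ltr0n.
have n0R : 0 < n%:R :> R by rewrite ltr0n.
have a10 : 0 < n.-1%:R / 2 :> R by rewrite divr_gt0.
have b10 : 0 < 2 / n.-1%:R :> R by rewrite divr_gt0.
have b20 : 0 < 2 / n%:R :> R by rewrite divr_gt0.
have a12 : n.-1%:R / 2 < n%:R / 2 :> R by rewrite ltr_pM2r// ltr_nat prednK.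
have p01 : 0 < alpha / 2 < 1 by apply/andP; split; lra.
have q01 : 0 < 1 - alpha / 2 < 1 by apply/andP; split; lra.
have pq : alpha / 2 < 1 - alpha / 2 by lra.
move=> al_star.
have [x [x0 F12 _] alE] := alpha_star_crossing _ n2 (lt_trans al0 al_star).
rewrite /ci_avg_length ltr_pM2l ?exprn_gt0//.
apply: (gamma_reciprocal_spread _ _ _ _ x _ _ _ _ _ _ a10 a12 b10 b20 pq).
- exact: scaled_chi2_quantile n1 p01.
- exact: scaled_chi2_quantile n1 q01.
- exact: scaled_chi2_quantile n0 p01.
- exact: scaled_chi2_quantile n0 q01.
- exact: ltW.
- rewrite /scaled_chi2_cdf in alE; rewrite -alE; apply: lt_trans al_star; lra.
- exact: F12.
Qed.

(** * Second moments of the normal distribution *)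

(** The normal density is almost everywhere the Radon-Nikodym derivative, as
    both have the same integral over every measurable set. *)
Lemma ge0_integral_normal_prob {R : realType} (m s : R) (f : R -> \bar R) :
  measurable_fun setT f -> (forall x, 0 <= f x)%E ->
  (\int[normal_prob m s]_x f x =
   \int[lebesgue_measure]_x (f x * (normal_pdf m s x)%:E))%E.
Proof.
move=> mf f0; have dom := normal_prob_dominates m s.
rewrite -(Radon_Nikodym_SigmaFinite.change_of_variables dom)//.
have intg := Radon_Nikodym_SigmaFinite.f_integrable dom.
apply: ae_eq_integral => //.
- by apply: emeasurable_funM => //; exact: measurable_int intg.
- apply: emeasurable_funM => //; apply/measurable_EFinP.
  exact: measurable_normal_pdf.
- apply: ae_eqe_mul2l; apply: integral_ae_eq => //.
  + by apply/measurable_EFinP; exact: measurable_normal_pdf.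
  + by move=> E _ mE; rewrite -Radon_Nikodym_SigmaFinite.f_integral.
Qed.

Lemma is_derive_normal_pdf {R : realType} (m s x : R) : s != 0 ->
  is_derive x 1 (normal_pdf m s) (- ((x - m) / s ^+ 2) * normal_pdf m s x).
Proof.
move=> s0; rewrite normal_pdfE// /normal_fun.
pose e (y : R) := - (y - m) ^+ 2 / (s ^+ 2 *+ 2).
have H1 : is_derive x 1 e (- ((x - m) / s ^+ 2)).
  apply: is_derive_eq.
  by rewrite /GRing.scale /=; field.
have H2 := is_derive_expR (e x).
have H3 := @is_derive1_comp R expR e _ _ _ H2 H1.
have H4 : is_derive x 1 (fun y : R => normal_peak s * (expR \o e) y)
  (normal_peak s *: (expR (e x) * (- ((x - m) / s ^+ 2)))).
  exact: is_deriveZ.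
apply: (is_derive_eq H4).
by rewrite /GRing.scale /=; ring.
Qed.

(** With $g' = - \frac{x - m}{s^2} g$, the derivative of
    $- s^2 (x - m + 2c) g$ is $((x - m + c)^2 - s^2 - c^2) g$. *)
Lemma integral_normal_itv {R : realType} (m s c k : R) : s != 0 -> 0 < k ->
  (\int[lebesgue_measure]_(x in `[(m - k)%R, (m + k)%R])
     (((x - m + c) ^+ 2 - (s ^+ 2 + c ^+ 2)) * normal_pdf m s x)%:E =
   (- (s ^+ 2 * (k *+ 2) * normal_pdf m s (m + k)))%:E)%E.
Proof.
move=> s0 k0.
(* the antiderivative, by the differential equation of the density *)
pose F x := - (s ^+ 2 * ((x - m + c *+ 2) * normal_pdf m s x)).
have -> : - (s ^+ 2 * (k *+ 2) * normal_pdf m s (m + k)) =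
    F (m + k) - F (m - k).
  rewrite /F normal_pdfE// /normal_fun.
  have -> : m + k - m = k by ring.
  have -> : m - k - m = - k by ring.
  by rewrite sqrrN; ring.
apply: integral_is_derive.
- by rewrite ltrD2l gtrN.
- move=> x _; have H := is_derive_normal_pdf m s x s0.
  apply: is_derive_eq; rewrite /GRing.scale /=.
  by field.
- move=> x _; have H := is_derive_normal_pdf m s x s0.
  by apply: derivableM; apply: ex_derive.
Qed.

Lemma cvg_normal_boundary {R : realType} (m s : R) : s != 0 ->
  s ^+ 2 * (n.+1%:R *+ 2) * normal_pdf m s (m + n.+1%:R) @[n --> \oo] -->
  (0 : R).
Proof.
move=> s0; have s20 : 0 < s ^+ 2 by rewrite exprn_even_gt0.
(* from expR (- u) <= u^-1 at u = k ^+ 2 / (2 s ^+ 2), with k = n.+1 *)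
pose C := s ^+ 2 * 2 * normal_peak s * (s ^+ 2 *+ 2).
apply: (@squeeze_cvgr _ _ _ _ (fun=> 0) (fun n => C * n.+1%:R^-1));
  last 2 first.
- exact: cvg_cst.
- rewrite -[X in _ --> X](mulr0 C); apply: cvgM; first exact: cvg_cst.
  exact: cvg_harmonic.
apply: nearW => n; apply/andP; split.
  apply: mulr_ge0; last exact: normal_pdf_ge0.
  by apply: mulr_ge0; [exact: sqr_ge0|rewrite mulrn_wge0 ?ler0n].
rewrite normal_pdfE// /normal_fun.
set k := n.+1%:R; have k0 : 0 < k by rewrite ltr0n.
have -> : m + k - m = k by ring.
have e_le : expR (- k ^+ 2 / (s ^+ 2 *+ 2)) <= (s ^+ 2 *+ 2) / k ^+ 2.
  have d0 : 0 < s ^+ 2 *+ 2 by rewrite mulrn_wgt0.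
  rewrite mulNr expRN -[leRHS]invf_div.
  rewrite lef_pV2 ?posrE ?expR_gt0 ?divr_gt0 ?exprn_gt0//.
  by apply: le_trans (expR_ge1Dx _); rewrite lerDr.
have -> : C / k = s ^+ 2 * (k *+ 2) * (normal_peak s * (s ^+ 2 *+ 2 / k ^+ 2)).
  by rewrite /C; field; rewrite gt_eqF.
apply: ler_wpM2l.
  by apply: mulr_ge0; [exact: sqr_ge0|rewrite mulrn_wge0 ?ltW].
by apply: ler_wpM2l => //; exact: normal_peak_ge0.
Qed.

Lemma cvg_integral_symmetric_itv {R : realType} (m : R) (f : R -> R) :
  measurable_fun setT f -> (forall x, 0 <= f x) ->
  (\int[lebesgue_measure]_(x in `[(m - n.+1%:R)%R, (m + n.+1%:R)%R]) (f x)%:E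
     @[n --> \oo] --> \int[lebesgue_measure]_x (f x)%:E)%E.
Proof.
move=> mf f0; pose F n := `[(m - n.+1%:R)%R, (m + n.+1%:R)%R]%classic.
have -> : [set: R] = \bigcup_n F n.
  apply/esym/seteqP; split => // x _; exists (Num.truncn `|x - m|) => //=.
  by rewrite /F/= in_itv/= -ler_distl ltW// truncnS_gt.
apply: ge0_nondecreasing_set_cvg_integral => //.
- apply/nondecreasing_seqP => n; apply/subsetPset => x /=.
  rewrite !in_itv/= => /andP[h1 h2]; rewrite (le_trans _ h1) ?(le_trans h2)//.
    by rewrite lerD2l ler_nat.
  by rewrite lerD2l lerN2 ler_nat.
- by move=> i; apply/measurable_EFinP; apply: measurable_funTS.
- by move=> i x _; rewrite lee_fin.
Qed.

(** The square is centred at an arbitrary a, so that both the mean and the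
    variance can be read off from nonnegative integrals only. *)
Lemma second_moment_normal_prob {R : realType} (m s a : R) : s != 0 ->
  (\int[normal_prob m s]_x ((x - a) ^+ 2)%:E = (s ^+ 2 + (m - a) ^+ 2)%:E)%E.
Proof.
move=> s0.
have mpdf := measurable_normal_pdf m s.
have mf : measurable_fun setT (fun x : R => (x - a) ^+ 2).
  by apply: measurable_funX; exact: measurable_funB.
rewrite ge0_integral_normal_prob//; last 2 first.
- exact/measurable_EFinP.
- by move=> x; rewrite lee_fin sqr_ge0.
pose f x := (x - a) ^+ 2 * normal_pdf m s x.
transitivity (\int[lebesgue_measure]_x (f x)%:E)%E.
  by apply: eq_integral => x _; rewrite -EFinM.
pose c := m - a.
pose F n : set R := `[(m - n.+1%:R)%R, (m + n.+1%:R)%R]%classic.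
pose V n := (\int[lebesgue_measure]_(x in F n) (normal_pdf m s x)%:E)%E.
have Vfin n : V n \is a fin_num.
  apply: integrable_fin_num; first exact: measurable_itv.
  apply: integrableS (integrable_normal_pdf m s) => //.
  exact: measurable_itv.
have V1 : fine (V n) @[n --> \oo] --> (1 : R).
  apply: fine_cvg; rewrite -(integral_normal_pdf m s).
  by apply: cvg_integral_symmetric_itv => // x; exact: normal_pdf_ge0.
have U1 : (\int[lebesgue_measure]_(x in F n) (f x)%:E @[n --> \oo] -->
    \int[lebesgue_measure]_x (f x)%:E)%E.
  apply: cvg_integral_symmetric_itv; first exact: measurable_funM.
  by move=> x; rewrite mulr_ge0 ?sqr_ge0 ?normal_pdf_ge0.
have UE n : (\int[lebesgue_measure]_(x in F n) (f x)%:E =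
    ((s ^+ 2 + c ^+ 2) * fine (V n) -
      s ^+ 2 * (n.+1%:R *+ 2) * normal_pdf m s (m + n.+1%:R))%:E)%E.
  have k0 : 0 < n.+1%:R :> R by rewrite ltr0n.
  have := integral_normal_itv m s c _ s0 k0; rewrite -/(F n) => IE.
  have mF : measurable (F n : set (measurableTypeR R)) by exact: measurable_itv.
  pose h x := ((x - m + c) ^+ 2 - (s ^+ 2 + c ^+ 2)) * normal_pdf m s x.
  have dh x : derivable h x 1.
    have H := is_derive_normal_pdf m s x s0.
    by apply: derivableM; apply: ex_derive.
  have inth : lebesgue_measure.-integrable (F n) (EFin \o h).
    apply: continuous_compact_integrable; first exact: segment_compact.
    by apply: derivable_within_continuous.
  have intg : lebesgue_measure.-integrable (F n) (EFin \o normal_pdf m s).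
    by apply: integrableS (integrable_normal_pdf m s).
  have intcg := integrableZl mF (s ^+ 2 + c ^+ 2) intg.
  rewrite EFinB EFinM /V fineK; last exact: (Vfin n).
  rewrite -integralZl// -EFinN -IE addeC -integralD//.
  apply: eq_integral => x _; rewrite /= -EFinM -EFinD /f /h /c.
  by congr EFin; ring.
have U2 : (\int[lebesgue_measure]_(x in F n) (f x)%:E @[n --> \oo] -->
    (s ^+ 2 + c ^+ 2)%:E)%E.
  under eq_fun do rewrite UE.
  apply: cvg_EFin; first exact: nearW.
  rewrite -[X in _ --> X]subr0; apply: cvgB; last exact: cvg_normal_boundary.
  rewrite -[X in _ --> X]mulr1; apply: cvgM => //; exact: cvg_cst.
by rewrite -(cvg_lim _ U1)// (cvg_lim _ U2).
Qed.

(** * Means of random variables *)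

(** Integrability is kept together with the value of the mean, so that linear
    combinations need no side condition. *)
Definition has_mean {d : measure_display} {T : measurableType d} {R : realType}
    (P : probability T R) (f : T -> R) (v : R) : Prop :=
  P.-integrable setT (EFin \o f) /\ (\int[P]_t (f t)%:E = v%:E)%E.

Lemma has_meanD {d : measure_display} {T : measurableType d} {R : realType}
    (P : probability T R) (f g : T -> R) (u v : R) :
  has_mean P f u -> has_mean P g v -> has_mean P (fun t => f t + g t) (u + v).
Proof.
move=> [fi fu] [gi gv]; split.
  by have := integrableD measurableT fi gi; apply: eq_integrable.
by under eq_integral do rewrite EFinD; rewrite integralD// fu gv.
Qed.

Lemma has_meanZ {d : measure_display} {T : measurableType d} {R : realType}
    (P : probability T R) (f : T -> R) (k u : R) :
  has_mean P f u -> has_mean P (fun t => k * f t) (k * u).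
Proof.
move=> [fi fu]; split.
  by have := integrableZl measurableT k fi; apply: eq_integrable.
by under eq_integral do rewrite EFinM; rewrite integralZl// fu.
Qed.

Lemma has_mean_cst {d : measure_display} {T : measurableType d} {R : realType}
    (P : probability T R) (k : R) : has_mean P (fun=> k) k.
Proof.
split; last by rewrite integral_cst//= probability_setT mule1.
exact: finite_measure_integrable_cst.
Qed.

Lemma has_mean_sum {d : measure_display} {T : measurableType d} {R : realType}
    (P : probability T R) (n : nat) (f : 'I_n -> T -> R) (u : 'I_n -> R) :
  (forall i, has_mean P (f i) (u i)) ->
  has_mean P (fun t => \sum_(i < n) f i t) (\sum_(i < n) u i).
Proof.
elim: n f u => [|n IH] f u fu.
  rewrite big_ord0; under eq_fun do rewrite big_ord0; exact: has_mean_cst.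
rewrite big_ord_recl; under eq_fun do rewrite big_ord_recl.
by apply: has_meanD => //; apply: IH.
Qed.

(** The product rule on rectangles identifies the joint law of X and Y with the
    product of their laws, and Fubini's theorem applies. *)
Lemma mean_indep {d : measure_display} {T : measurableType d} {R : realType}
    (P : probability T R) (X Y : {RV P >-> R}) (u v : R) :
  (forall A B : set R, measurable A -> measurable B ->
    P ((X @^-1` A) `&` (Y @^-1` B)) = (P (X @^-1` A) * P (Y @^-1` B))%E) ->
  P.-integrable setT (EFin \o (fun t => X t * Y t)) ->
  has_mean P X u -> has_mean P Y v ->
  has_mean P (fun t => X t * Y t) (u * v).
Proof.
move=> indep XYi [Xi Xu] [Yi Yv]; split=> //.
pose Z (t : T) : R * R := (X t, Y t).
have mZ : measurable_fun setT Z by exact: measurable_fun_pair.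
pose ZI := isMeasurableFun.Build _ _ _ _ _ mZ.
pose Zm : {mfun _ >-> _} := HB.pack Z ZI.
pose mu1 := distribution P X; pose mu2 := distribution P Y.
pose g (z : R * R) := (z.1 * z.2)%:E.
have mg : measurable_fun setT g.
  by apply/measurable_EFinP; exact: measurable_funM.
have prodE A : measurable A -> (mu1 \x mu2)%E A = distribution P Zm A.
  move=> mA; apply: product_measure_unique.
    by move=> B C mB mC; exact: (indep B C mB mC).
  exact: mA.
have gi : (mu1 \x mu2)%E.-integrable setT g.
  apply/integrableP; split => //.
  rewrite (eq_measure_integral (distribution P Zm)); last first.
    by move=> A mA _; exact: prodE.
  rewrite ge0_integral_distribution//; last exact: measurableT_comp.
  by case/integrableP : XYi.
transitivity (\int[distribution P Zm]_z g z)%E.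
  by rewrite (integral_distribution (X := Zm) mg).
rewrite (eq_measure_integral (mu1 \x mu2)%E); last first.
  by move=> A mA _; exact/esym/prodE.
rewrite -(integral12_prod_meas1 gi) /fubini_F.
have mEid : measurable_fun [set: R] (@EFin R \o id) by exact/measurable_EFinP.
have idi1 : mu1.-integrable setT (EFin \o id).
  exact: (integrable_pushforward (phi := X)).
have idi2 : mu2.-integrable setT (EFin \o id).
  exact: (integrable_pushforward (phi := Y)).
have I1 : (\int[mu1]_x (EFin \o id) x = u%:E)%E.
  by rewrite integral_distribution.
have I2 : (\int[mu2]_y (EFin \o id) y = v%:E)%E.
  by rewrite integral_distribution.
have inner x : (\int[mu2]_y g (x, y) = (EFin \o id) x * v%:E)%E.
  by rewrite -I2 -integralZl//; apply: eq_integral.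
under eq_integral do rewrite inner.
by rewrite integralZr// I1 EFinM.
Qed.

(** * Expectation of the sample variance *)

Lemma mutually_independent_pair {d : measure_display} {T : measurableType d}
    {R : realType} {P : probability T R} {n : nat} (X : 'I_n -> {RV P >-> R})
    (i j : 'I_n) (A B : set R) :
  mutually_independent X -> i != j -> measurable A -> measurable B ->
  P ((X i @^-1` A) `&` (X j @^-1` B)) = (P (X i @^-1` A) * P (X j @^-1` B))%E.
Proof.
move=> indep ij mA mB.
pose C k : set R := if k == i then A else if k == j then B else setT.
have mC k : measurable (C k) by rewrite /C; case: ifP => // _; case: ifP.
have := indep C mC.
have ji : (j == i) = false by rewrite eq_sym; exact/negbTE.
rewrite (bigD1 i)//= (bigD1 j) ?ji//=.
rewrite big1 => [|k /andP[/negbTE ki /negbTE kj]]; last first.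
  by rewrite /C ki kj preimage_setT probability_setT.
rewrite mule1 {2 3}/C eqxx ji eqxx => <-; congr (P _).
apply/seteqP; split => t /=.
  move=> [At Bt] k _; rewrite /C.
  by have [->|_] := eqVneq k i => //; have [->|_] := eqVneq k j.
move=> H; split.
  by have := H i I; rewrite /C eqxx.
by have := H j I; rewrite /C ji eqxx.
Qed.

Lemma has_mean_normal_sq {d : measure_display} {T : measurableType d}
    {R : realType} {P : probability T R} (X : {RV P >-> R}) (mu s a : R) :
  s != 0 ->
  (forall B : set R, measurable B -> distribution P X B = normal_prob mu s B) ->
  has_mean P (fun t => (X t - a) ^+ 2) (s ^+ 2 + (mu - a) ^+ 2).
Proof.
move=> s0 XN.
have mf : measurable_fun setT (fun x : R => (x - a) ^+ 2).
  by apply: measurable_funX; exact: measurable_funB.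
have f0 x : (0 <= ((x - a) ^+ 2)%:E)%E by rewrite lee_fin sqr_ge0.
have E2 : (\int[P]_t ((X t - a) ^+ 2)%:E = (s ^+ 2 + (mu - a) ^+ 2)%:E)%E.
  (* X is retyped because normal_prob is a measure on measurableTypeR *)
  pose Y : T -> measurableTypeR R := X.
  have mY : measurable_fun setT Y by exact: (measurable_funP X).
  pose YI := isMeasurableFun.Build _ _ _ _ _ mY.
  pose Ym : {mfun T >-> measurableTypeR R} := HB.pack Y YI.
  rewrite -(second_moment_normal_prob mu s a s0).
  rewrite (eq_measure_integral (distribution P Ym)); last first.
    by move=> A mA _; exact/esym/XN.
  by rewrite ge0_integral_distribution//; exact/measurable_EFinP.
split=> //; apply/integrableP; split.
  by apply/measurable_EFinP; apply: (measurableT_comp mf).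
under eq_integral do rewrite /= ger0_norm ?sqr_ge0//.
by rewrite E2 ltry.
Qed.

(** The mean is recovered from the second moments around 0 and -1. *)
Lemma has_mean_normal {d : measure_display} {T : measurableType d}
    {R : realType} {P : probability T R} (X : {RV P >-> R}) (mu s : R) :
  s != 0 ->
  (forall B : set R, measurable B -> distribution P X B = normal_prob mu s B) ->
  has_mean P X mu.
Proof.
move=> s0 XN.
have h0 := has_mean_normal_sq X mu s 0 s0 XN.
have h1 := has_mean_normal_sq X mu s (-1) s0 XN.
(* X = ((X + 1)^2 - X^2 - 1) / 2 *)
have := has_meanZ P _ (2^-1) _ (has_meanD P _ _ _ _ (has_meanD P _ _ _ _ h1
  (has_meanZ P _ (-1) _ h0)) (has_mean_cst P (-1))).
congr (has_mean P _ _); last by field.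
by apply/funext => t; field.
Qed.

Lemma has_mean_normalM {d : measure_display} {T : measurableType d}
    {R : realType} {P : probability T R} {n : nat} (X : 'I_n -> {RV P >-> R})
    (mu s : R) (i j : 'I_n) : s != 0 -> iid_normal X mu s ->
  has_mean P (fun t => X i t * X j t) (mu ^+ 2 + (i == j)%:R * s ^+ 2).
Proof.
move=> s0 [indep XN].
have sq k : has_mean P (fun t => X k t ^+ 2) (s ^+ 2 + mu ^+ 2).
  have := has_mean_normal_sq (X k) mu s 0 s0 (XN k); rewrite subr0.
  by under eq_fun do rewrite subr0.
have [<-|ij] := eqVneq i j.
  by rewrite mul1r addrC; have := sq i; under eq_fun do rewrite expr2.
rewrite mul0r addr0 expr2; apply: mean_indep.
- by move=> A B; exact: mutually_independent_pair.
- (* |X Y| <= X^2 + Y^2 *)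
  have [sqi _] := has_meanD P _ _ _ _ (sq i) (sq j).
  apply: le_integrable sqi => //.
    by apply/measurable_EFinP; exact: measurable_funM.
  move=> t _ /=; rewrite lee_fin [leRHS]ger0_norm ?addr_ge0 ?sqr_ge0//.
  rewrite ler_norml; apply/andP; split.
    by have := sqr_ge0 (X i t + X j t); nra.
  by have := sqr_ge0 (X i t - X j t); nra.
- exact: has_mean_normal s0 (XN i).
- exact: has_mean_normal s0 (XN j).
Qed.

(** In this form only the moments of the products of two observations matter. *)
Lemma sum_sqr_dev {R : fieldType} (n : nat) (x : 'I_n -> R) : n%:R != 0 :> R ->
  \sum_(i < n) (x i - n%:R^-1 * \sum_(j < n) x j) ^+ 2 =
  \sum_(i < n) x i * x i +
    - n%:R^-1 * \sum_(i < n) \sum_(j < n) x i * x j.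
Proof.
move=> n0; rewrite -big_distrlr/=; set S := \sum_(j < n) x j.
transitivity (\sum_(i < n) (x i * x i + (- (2 * n%:R^-1 * S) * x i +
    (n%:R^-1 * S) ^+ 2))).
  by apply: eq_bigr => i _; ring.
rewrite !big_split/= -mulr_sumr sumr_const card_ord -/S -mulr_natl.
by field.
Qed.

(** The terms in $\mu^2$ cancel, and $\sigma^2$ survives with the factor
    $n - n/n = n - 1$. *)
Lemma has_mean_sum_sqr_dev {d : measure_display} {T : measurableType d}
    {R : realType} {P : probability T R} {n : nat} (X : 'I_n -> {RV P >-> R})
    (mu s : R) : (0 < n)%N -> s != 0 -> iid_normal X mu s ->
  has_mean P (fun t => \sum_(i < n) (X i t - sample_mean X t) ^+ 2)
    (n.-1%:R * s ^+ 2).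
Proof.
move=> n0 s0 XN; have nR0 : n%:R != 0 :> R by rewrite pnatr_eq0 -lt0n.
have XX i j := has_mean_normalM X mu s i j s0 XN.
have := has_meanD P _ _ _ _ (has_mean_sum P n _ _ (fun i => XX i i))
  (has_meanZ P _ (- n%:R^-1) _ (has_mean_sum P n _ _
     (fun i => has_mean_sum P n _ _ (fun j => XX i j)))).
congr (has_mean P _ _).
  by apply/funext => t; rewrite /sample_mean sum_sqr_dev.
under eq_bigr do rewrite eqxx mul1r.
under [X in _ + _ * X]eq_bigr => i _.
  rewrite big_split/= sumr_const card_ord (bigD1 i)//= eqxx mul1r big1 ?addr0.
    over.
  by move=> j; rewrite eq_sym => /negbTE ->; rewrite mul0r.
rewrite !sumr_const card_ord.
have -> : n.-1%:R = n%:R - 1 :> R by rewrite -[in RHS](prednK n0) -natr1 addrK.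
by field.
Qed.

Lemma ci_avg_length_expected {R : realType} (mu sigma alpha : R) (n : nat) :
  0 < sigma -> (2 <= n)%N ->
  is_ci_avg_length mu sigma alpha n (ci_avg_length sigma alpha n).
Proof.
move=> s0 n2 d T P X XN; rewrite unlock.
have n0 : (0 < n)%N := ltnW n2.
have n1 : n.-1%:R != 0 :> R by rewrite pnatr_eq0 -lt0n -ltnS prednK.
have := has_mean_sum_sqr_dev X mu sigma n0 (lt0r_neq0 s0) XN.
rewrite /ci_avg_length; set p := chi2_quantile _ _; set q := chi2_quantile _ _.
move=> /(has_meanZ P _ (p^-1 - q^-1))[_ E].
transitivity (((p^-1 - q^-1) * (n.-1%:R * sigma ^+ 2))%:E).
  rewrite -E; apply: eq_integral => t _; congr EFin.
  rewrite /ci_upper /ci_lower -/p -/q /sample_variance !mulrA divff// !mul1r.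
  by rewrite mulrBl ![_^-1 * _]mulrC.
by congr EFin; rewrite !div1r !invf_div; ring.
Qed.

Theorem mainTheorem2 (R : realType) (mu sigma : R) (n : nat) (alpha : R)
    (sigma_gt0 : 0 < sigma) (n_ge2 : (2 <= n)%N)
    (alpha_gt0 : 0 < alpha) (alpha_lt1 : alpha < 1) :
  [/\ is_ci_avg_length mu sigma alpha n (ci_avg_length sigma alpha n),
      is_ci_avg_length mu sigma alpha n.+1 (ci_avg_length sigma alpha n.+1)
    & alpha < alpha_star n ->
      ci_avg_length sigma alpha n > ci_avg_length sigma alpha n.+1].
Proof.
split.
- exact: ci_avg_length_expected.
- by apply: ci_avg_length_expected => //; exact: leqW.
- exact: ci_avg_length_lt.
Qed.
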